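(* Let $G=(V,E)$ be an undirected graph, $K\subseteq V$, $f:(\{0,1\}^n)^K\to\{0,1\}$ and $\epsilon\ge0$. Assume that for some $n'>0$ the following holds: for every pair of distinct players $a,b\in K$ there exists $\tilde{\mathbf{x}}\in(\{0,1\}^n)^{K\setminus\{a,b\}}$ such that $R^{(2)}_\epsilon(f_{\{a\},\{b\},\tilde{\mathbf{x}}})\ge n'$. Then \[\min_{\Delta\in [|V|]} \left(\frac{n'}{\mathrm{ST}(G,K,\Delta)}+\Delta\right) \leq \tilde O\Big(R_\epsilon(f, G, K)\Big).\]
   Context: Communication model: $G$ undirected simple graph, $K\subseteq V$ terminals, $k=|K|$; each $u\in K$ receives $\mathbf{x}_u\in\{0,1\}^n$ and all terminals must learn $f$. In each synchronous round every node sends a (possibly different) bit to each neighbour, both directions usable simultaneously; protocols know $G$ and use public randomness. $R_\epsilon(f,G,K)$: minimum worst-case number of rounds of a protocol erring with probability $\le\epsilon$ on every input. $R^{(2)}_\epsilon(g)$: randomized round complexity of a two-party function $g$ when Alice and Bob may each send one bit to the other simultaneously in each round. $\tilde O$ ignores poly-logarithmic factors in the size of $G$ and $n$. For disjoint nonempty $A,B\subseteq K$ and $\tilde{\mathbf{x}}\in(\{0,1\}^n)^{K\setminus(A\cup B)}$, $f_{A,B,\tilde{\mathbf{x}}}:(\{0,1\}^n)^A\times(\{0,1\}^n)^B\to\{0,1\}$ is $f_{A,B,\tilde{\mathbf{x}}}(\mathbf{x}_A,\mathbf{x}_B)=f(\mathbf{y})$ where $\mathbf{y}[v]$ equals $\mathbf{x}_A[v]$,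 $\mathbf{x}_B[v]$, or $\tilde{\mathbf{x}}[v]$ according as $v\in A$, $v\in B$, or otherwise. $\mathrm{ST}(G,K,\Delta)$ is the optimum of $\max\sum_{T\in\mathcal{T}_{\Delta,K}}z_T$ s.t. $\sum_{T\ni e}z_T\le1$ for all $e\in E$, $z\ge0$, where $\mathcal{T}_{\Delta,K}$ is the set of Steiner trees in $G$ spanning $K$ in which any two terminals are at distance at most $\Delta$.
   Formalization: The formal theorem assumes at least two terminals, |K| ≥ 2; for |K| ≤ 1 the hypothesis on pairs is vacuous, R_ε(f,G,K) = 0 and the left side is at least 1, so the claim as written fails there. *)

(* Defs.v *)
From HB Require Import structures.
From mathcomp Require Import all_boot all_order all_algebra.
From mathcomp Require Import all_classical all_reals all_analysis.

Set Implicit Arguments.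
Unset Strict Implicit.
Unset Printing Implicit Defensive.

Import Order.TTheory GRing.Theory Num.Theory.
Local Open Scope ring_scope.

Record sgraph (V : finType) := SGraph {
  adj : rel V;
  adj_sym : symmetric adj;
  adj_irrefl : irreflexive adj }.

Definition edges (V : finType) (G : sgraph V) : {set {set V}} :=
  [set [set p.1; p.2] | p in [pred p : V * V | adj G p.1 p.2]]%SET.

(** ** Inputs *)

Definition inputs (V : finType) (n : nat) (A : {set V}) : finType :=
  {ffun {v : V | v \in A} -> n.-tuple bool}.

(* [None] when [v] is not in [A]: such a node holds no input. *)
Definition local_input (V : finType) (n : nat) (A : {set V})
    (x : inputs n A) (v : V) : option (n.-tuple bool) :=
  omap x (insub v).

(* For v in K one of the three local inputs is present, so the all-zero default
   is never used. *)
Definition glue (V : finType) (n : nat) (K A B : {set V})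
    (xA : inputs n A) (xB : inputs n B)
    (xt : inputs n (K :\: (A :|: B))%SET) : inputs n K :=
  [ffun v => if local_input xA (val v) is Some b then b
             else if local_input xB (val v) is Some b then b
             else if local_input xt (val v) is Some b then b
             else [tuple of nseq n false]].

Definition fAB (V : finType) (n : nat) (K : {set V}) (f : inputs n K -> bool)
    (A B : {set V}) (xt : inputs n (K :\: (A :|: B))%SET)
    (xA : inputs n A) (xB : inputs n B) : bool :=
  f (glue xA xB xt).

(** ** Public randomness: a seed drawn from a finite distribution *)

Record pmf (R : realType) (Omega : finType) := PMF {
  pmf_fun :> Omega -> R;
  pmf_ge0 : forall w, 0 <= pmf_fun w;
  pmf_sum1 : \sum_w pmf_fun w = 1 }.

(** ** Protocols on a network *)

(* What a node knows besides the seed and its own input is the list, oldest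
   round first, of the bits received, indexed by sender. *)
Definition history (V : finType) := seq {ffun V -> bool}.

(* [net_send w u i h v] is the bit that [u], with local input [i] and history
   [h], sends to [v] in round [size h]. *)
Record net_protocol (V : finType) (n : nat) (Omega : finType) := NetProtocol {
  net_send : Omega -> V -> option (n.-tuple bool) -> history V -> V -> bool;
  net_output : Omega -> V -> option (n.-tuple bool) -> history V -> bool }.

(* Entries for non-neighbours of [v] are forced to [false]: bits travel along
   edges only. *)
Fixpoint net_history (V : finType) (G : sgraph V) (K : {set V}) (n : nat)
    (Omega : finType) (P : net_protocol V n Omega) (w : Omega)
    (x : inputs n K) (t : nat) (v : V) : history V :=
  if t is t'.+1 then
    rcons (net_history G P w x t' v)
      [ffun u => adj G u v &&
         net_send P w u (local_input x u) (net_history G P w x t' u) v]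
  else [::].

Definition net_errs (V : finType) (G : sgraph V) (K : {set V}) (n : nat)
    (f : inputs n K -> bool) (Omega : finType) (P : net_protocol V n Omega)
    (r : nat) (x : inputs n K) (w : Omega) : bool :=
  [exists v in K,
    net_output P w v (local_input x v) (net_history G P w x r v) != f x].

Definition net_computes (R : realType) (V : finType) (G : sgraph V)
    (K : {set V}) (n : nat) (f : inputs n K -> bool) (eps : R) (r : nat) : Prop :=
  exists (Omega : finType) (mu : pmf R Omega) (P : net_protocol V n Omega),
    forall x : inputs n K, \sum_(w | net_errs G f P r x w) mu w <= eps.

(* +oo if no protocol exists (e.g. terminals in different components). *)
Definition net_rounds (R : realType) (V : finType) (n : nat) (eps : R)
    (G : sgraph V) (K : {set V}) (f : inputs n K -> bool) : \bar R :=
  ereal_inf [set (r%:R)%:E | r in [set r : nat | net_computes G f eps r]]%classic.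

(** ** Two-party protocols *)

(* The [seq bool] argument is the list of bits received from the other party,
   oldest first. *)
Record two_protocol (X Y Omega : Type) := TwoProtocol {
  alice_send : Omega -> X -> seq bool -> bool;
  bob_send : Omega -> Y -> seq bool -> bool;
  alice_output : Omega -> X -> seq bool -> bool;
  bob_output : Omega -> Y -> seq bool -> bool }.

Fixpoint two_history (X Y Omega : Type) (P : two_protocol X Y Omega)
    (w : Omega) (x : X) (y : Y) (t : nat) : seq bool * seq bool :=
  if t is t'.+1 then
    let: (ha, hb) := two_history P w x y t' in
    (rcons ha (bob_send P w y hb), rcons hb (alice_send P w x ha))
  else ([::], [::]).

(* As in the network model, both players must learn the value. *)
Definition two_errs (X Y Omega : Type) (g : X -> Y -> bool)
    (P : two_protocol X Y Omega) (r : nat) (x : X) (y : Y) (w : Omega) : bool :=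
  let: (ha, hb) := two_history P w x y r in
  (alice_output P w x ha != g x y) || (bob_output P w y hb != g x y).

Definition two_computes (R : realType) (X Y : Type) (g : X -> Y -> bool)
    (eps : R) (r : nat) : Prop :=
  exists (Omega : finType) (mu : pmf R Omega) (P : two_protocol X Y Omega),
    forall (x : X) (y : Y), \sum_(w | two_errs g P r x y w) mu w <= eps.

Definition two_rounds (R : realType) (X Y : Type) (eps : R)
    (g : X -> Y -> bool) : \bar R :=
  ereal_inf [set (r%:R)%:E | r in [set r : nat | two_computes g eps r]]%classic.

(** ** Fractional packing of bounded-diameter Steiner trees *)

Definition subgraph (V : finType) : finType := ({set V} * {set {set V}})%type.

Definition sub_adj (V : finType) (F : {set {set V}}) : rel V :=
  fun u v => [set u; v]%SET \in F.

Definition dist_le (V : finType) (e : rel V) (u v : V) (d : nat) : Prop :=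
  exists p : seq V, [/\ path e u p, last u p = v & (size p <= d)%N].

Definition is_tree (V : finType) (G : sgraph V) (T : subgraph V) : Prop :=
  [/\ T.1 != finset.set0,
      T.2 \subset edges G,
      (forall e, e \in T.2 -> e \subset T.1),
      (forall u v, u \in T.1 -> v \in T.1 -> connect (sub_adj T.2) u v) &
      (forall c : seq V, ucycle (sub_adj T.2) c -> (size c < 3)%N)].

(* Distances between terminals are measured inside the tree. *)
Definition is_steiner_tree (V : finType) (G : sgraph V) (K : {set V}) (D : nat)
    (T : subgraph V) : Prop :=
  [/\ is_tree G T,
      K \subset T.1 &
      forall u v, u \in K -> v \in K -> dist_le (sub_adj T.2) u v D].

Definition steiner_trees (V : finType) (G : sgraph V) (K : {set V}) (D : nat) :
    {set subgraph V} :=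
  [set T : subgraph V | `[< is_steiner_tree G K D T >]]%SET.

Definition feasible_packing (R : realType) (V : finType) (G : sgraph V)
    (K : {set V}) (D : nat) (z : subgraph V -> R) : Prop :=
  (forall T, T \in steiner_trees G K D -> 0 <= z T) /\
  (forall e, e \in edges G ->
     \sum_(T in steiner_trees G K D | e \in T.2) z T <= 1).

Definition ST (R : realType) (V : finType) (G : sgraph V) (K : {set V})
    (D : nat) : \bar R :=
  ereal_sup [set (\sum_(T in steiner_trees G K D) z T)%:E
            | z in [set z : subgraph V -> R | feasible_packing G K D z]]%classic.

(* Main.v *)
Require Import Defs.
From HB Require Import structures.
From mathcomp Require Import all_boot all_order all_algebra.
From mathcomp Require Import all_classical all_reals all_analysis.
From mathcomp Require Import zify lra ring.

Set Implicit Arguments.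
Unset Strict Implicit.
Unset Printing Implicit Defensive.

Import Order.TTheory GRing.Theory Num.Theory.
Local Open Scope ring_scope.

(** Fix an r-round network protocol and put [c = 2(2r+1)/n'].

    Let [y] be nonnegative edge weights such that every path of at most [2r]
    edges between two terminals [a], [b] has length at least [rho].  With
    integer edge lengths [1 + floor((2r+1) y / rho)] the vertices [a] and [b] are
    at distance at least [2r+1].  Alice and Bob can then simulate the protocol,
    the state of [v] after [t] rounds being known to Bob when [t] is below the
    distance from [a], and to Alice when [t] is below [2r+1] minus that
    distance: information travels one edge per round for free, so only the extra
    lengths [floor((2r+1) y / rho)] have to be paid for in bits, and hardness of
    the two-party function gives [rho <= c * sum y].

    Given [y] and a set of terminals, link each terminal to the nearest other one
    within [4r] edges.  The balls of half these distances are disjoint; applying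
    the previous bound to [y] restricted to each ball shows that all links together
    cost at most [4 c * sum y].  A dominating set of at most half of the
    terminals is kept, and after [O(log |K|)] phases a subgraph of depth
    [O(r log |K|)] and weight [O(c log |K|) * sum y] spans [K]; a
    breadth-first search in it yields a Steiner tree.  Since such a cheap tree exists
    for all weights [y], doubling the weights of the edges of the chosen trees
    (multiplicative weights) produces a fractional packing of value
    [Omega(1 / (c log |K|))]. *)

(** * Two-party simulation of a network protocol *)

Definition message (V : finType) (G : sgraph V) (K : {set V}) (n : nat)
    (Omega : finType) (P : net_protocol V n Omega) (w : Omega)
    (x : inputs n K) (t : nat) (u v : V) : bool :=
  net_send P w u (local_input x u) (net_history G P w x t u) v.

(** Every vertex is simulated, even those whose state the player cannot know; their entries may be
    wrong. [ans] overrides single messages by bits obtained from the other player, and [None] means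
    recomputing the message from the simulated sender. *)
Fixpoint simulated_history (V : finType) (G : sgraph V) (K : {set V}) (n : nat)
    (Omega : finType) (P : net_protocol V n Omega) (w : Omega)
    (x : inputs n K) (ans : nat -> V -> V -> option bool) (t : nat) (v : V) :
    history V :=
  if t is t'.+1 then
    rcons (simulated_history G P w x ans t' v)
      [ffun u => adj G u v &&
         odflt (net_send P w u (local_input x u)
                  (simulated_history G P w x ans t' u) v) (ans t' u v)]
  else [::].

(** By induction on [t]: a message that matters for [v] is either supplied correctly or sent by a
    vertex that is itself still simulated correctly, so wrong entries elsewhere never reach [v]
    before time [tau v]. *)
Lemma simulated_historyP (V : finType) (G : sgraph V) (K : {set V}) (n : nat)
    (Omega : finType) (P : net_protocol V n Omega) (w : Omega)
    (x x' : inputs n K) (ans : nat -> V -> V -> option bool)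
    (tau : V -> nat) (T : nat) :
  (forall u, (0 < tau u)%N -> local_input x' u = local_input x u) ->
  (forall t u v, (t < T)%N -> adj G u v -> (t.+1 < tau v)%N ->
     ans t u v = Some (message G P w x t u v) \/
     ans t u v = None /\ (t < tau u)%N) ->
  forall t v, (t <= T)%N -> (t < tau v)%N ->
    simulated_history G P w x' ans t v = net_history G P w x t v.
Proof.
move=> hx hans; elim=> [//|t IH] v tT tv /=.
rewrite IH ?(ltnW tT) ?(ltnW tv) //; congr rcons.
apply/ffunP=> u; rewrite !ffunE; case uv: (adj G u v) => //=.
have [-> //|[-> tu]] := hans t u v tT uv tv.
by rewrite /= IH ?(ltnW tT) // hx // (leq_ltn_trans _ tu).
Qed.

(* The message [(t, (u, v))] is needed by, but not known to, a player who knows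
   every vertex [v] up to time [tau v - 1]. *)
Definition crossing (V : finType) (tau : V -> nat) (s : nat * (V * V)) : bool :=
  (tau s.2.1 <= s.1)%N && (s.1.+1 < tau s.2.2)%N.

(** One list serves both players: each slot is one two-party round, with a bit in each direction.
    Sorting by round makes all messages of earlier rounds available when a slot is reached. *)
Definition slots (V : finType) (G : sgraph V) (tau sigma : V -> nat) (r : nat) :
    seq (nat * (V * V)) :=
  sort (fun s s' => (s.1 <= s'.1)%N)
    [seq s <- [seq (t, p) | t <- iota 0 r, p <- enum {: V * V}]
       | adj G s.2.1 s.2.2 && (crossing tau s || crossing sigma s)].

Lemma mem_slots (V : finType) (G : sgraph V) (tau sigma : V -> nat) (r : nat) s :
  (s \in slots G tau sigma r) =
  [&& (s.1 < r)%N, adj G s.2.1 s.2.2 & crossing tau s || crossing sigma s].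
Proof.
rewrite mem_sort mem_filter andbC; congr (_ && _).
case: s => t p /=; apply/allpairsP/idP => [[[t' p'] /= [ht _ [-> _]]]|ht].
  by rewrite mem_iota in ht.
by exists (t, p); rewrite mem_iota mem_enum; split.
Qed.

Lemma slots_earlier (V : finType) (G : sgraph V) (tau sigma : V -> nat) r s0 j s :
  (j < size (slots G tau sigma r))%N -> s \in slots G tau sigma r ->
  (s.1 < (nth s0 (slots G tau sigma r) j).1)%N ->
  (index s (slots G tau sigma r) < j)%N.
Proof.
set L := slots _ _ _ _ => jL sL; apply: contraTT; rewrite -!leqNgt => ji.
have /= := @sorted_leq_nth _ (fun s s' : nat * (V * V) => (s.1 <= s'.1)%N)
  _ _ s0 L _ j (index s L).
rewrite nth_index //; apply => //.
- by move=> ? ? ? /=; apply: leq_trans.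
- by apply: sort_sorted => ? ?; apply: leq_total.
- by rewrite inE index_mem.
Qed.

Lemma size_slots (V : finType) (G : sgraph V) (tau sigma : V -> nat) (r : nat) :
  size (slots G tau sigma r) =
  (\sum_(p : V * V | adj G p.1 p.2)
     \sum_(t < r) (crossing tau (val t, p) || crossing sigma (val t, p)))%N.
Proof.
rewrite size_sort size_filter -sum1_count big_mkcond /= big_allpairs.
rewrite exchange_big [RHS]big_mkcond /= -big_enum /=; apply: eq_bigr => p _.
rewrite -{1}[r]subn0 big_mkord; case: adj; last by rewrite big1.
by apply: eq_bigr => t _; case: (_ || _).
Qed.

(** The default [false] for slots not yet reached is harmless: correctness is claimed only up to a
    time before which all slots have been exchanged. *)
Definition answers (V : finType) (tau : V -> nat) (L : seq (nat * (V * V)))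
    (h : seq bool) (t : nat) (u v : V) : option bool :=
  if crossing tau (t, (u, v)) && ((t, (u, v)) \in L)
  then Some (nth false h (index (t, (u, v)) L)) else None.

(** The number of bits received identifies the current slot. Here [tau] is the horizon of the
    sender, who always answers from its own view; a bit it cannot know belongs to a slot that the
    receiver ignores. *)
Definition slot_bit (V : finType) (G : sgraph V) (K : {set V}) (n : nat)
    (Omega : finType) (P : net_protocol V n Omega) (tau : V -> nat)
    (L : seq (nat * (V * V))) (w : Omega) (x : inputs n K) (h : seq bool) : bool :=
  if drop (size h) L is (t, (u, v)) :: _ then
    net_send P w u (local_input x u)
      (simulated_history G P w x (answers tau L h) t u) v
  else false.

Definition correct_bits (V : finType) (G : sgraph V) (K : {set V}) (n : nat)
    (Omega : finType) (P : net_protocol V n Omega) (tau : V -> nat)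
    (L : seq (nat * (V * V))) (w : Omega) (x : inputs n K) (h : seq bool) : Prop :=
  forall s, s \in L -> (index s L < size h)%N -> crossing tau s ->
    nth false h (index s L) = message G P w x s.1 s.2.1 s.2.2.

Lemma simulate_answers (V : finType) (G : sgraph V) (K : {set V}) (n : nat)
    (Omega : finType) (P : net_protocol V n Omega) (w : Omega)
    (x x' : inputs n K) (tau sigma rho : V -> nat) (r T : nat) (h : seq bool) :
  (forall u, (0 < rho u)%N -> local_input x' u = local_input x u) ->
  (forall s, crossing rho s -> crossing tau s || crossing sigma s) ->
  let L := slots G tau sigma r in
  correct_bits G P rho L w x h ->
  (forall s, s \in L -> (s.1 < T)%N -> (index s L < size h)%N) ->
  (T <= r)%N ->
  forall v, (T < rho v)%N ->
    simulated_history G P w x' (answers rho L h) T v = net_history G P w x T v.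
Proof.
move=> hx hrho L hh hT Tr v Tv.
apply: (simulated_historyP (tau := rho) (T := T)) => // t u v' tT uv' tv'.
rewrite /answers; case: ifP => [/andP[cr sL]|].
  by left; rewrite hh // hT.
move=> /negbT; rewrite negb_and mem_slots /= (leq_trans tT Tr) uv' /=.
case: (boolP (crossing rho _)) => [/hrho -> //|]; rewrite /crossing /= tv' andbT -ltnNge.
by move=> tu _; right.
Qed.

(* The state of [v] after [t] rounds is known to Bob for [t < tau v] and to Alice
   for [t < sigma v]; no vertex is ever unknown to both. *)
Lemma simulate (R : realType) (V : finType) (G : sgraph V) (K : {set V}) (n : nat)
    (f : inputs n K -> bool) (eps : R) (r : nat) (a b : V)
    (xt : inputs n (K :\: ([set a] :|: [set b]))%SET) (tau sigma : V -> nat) :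
  a \in K -> b \in K ->
  tau a = 0%N -> sigma b = 0%N -> (r < tau b)%N -> (r < sigma a)%N ->
  (forall v, (r < tau v)%N || (r < sigma v)%N) ->
  net_computes G f eps r ->
  two_computes (fAB (A := [set a]%SET) (B := [set b]%SET) f xt) eps
    (size (slots G tau sigma r)).
Proof.
move=> aK bK taua sigb taub siga cov [W [mu [P hP]]].
pose L := slots G tau sigma r.
(* Each player fills in zeros for the other's input. This only affects the local input of the other
   terminal, where the player's horizon is 0. *)
pose x0 (A : {set V}) : inputs n A := [ffun=> [tuple of nseq n false]].
pose xa (xA : inputs n [set a]%SET) : inputs n K := Defs.glue xA (x0 [set b]%SET) xt.
pose xb (xB : inputs n [set b]%SET) : inputs n K := Defs.glue (x0 [set a]%SET) xB xt.
pose Q : two_protocol (inputs n [set a]%SET) (inputs n [set b]%SET) W :=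
  TwoProtocol
   (fun w xA h => slot_bit G P sigma L w (xa xA) h)
   (fun w xB h => slot_bit G P tau L w (xb xB) h)
   (fun w xA h => net_output P w a (local_input (xa xA) a)
      (simulated_history G P w (xa xA) (answers sigma L h) r a))
   (fun w xB h => net_output P w b (local_input (xb xB) b)
      (simulated_history G P w (xb xB) (answers tau L h) r b)).
exists W, mu, Q => xA xB; apply: le_trans (hP (Defs.glue xA xB xt)).
set x := Defs.glue xA xB xt.
have hxa u : (0 < sigma u)%N -> local_input (xa xA) u = local_input x u.
  move=> su; have ub : u != b by apply: contraTneq su => ->; rewrite sigb.
  rewrite /local_input; case: insubP => //= v _ vu; congr Some.
  rewrite !ffunE /local_input; case: (insub (val v)) => //=.
  by rewrite insubN ?vu ?inE.
have hxb u : (0 < tau u)%N -> local_input (xb xB) u = local_input x u.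
  move=> su; have ua : u != a by apply: contraTneq su => ->; rewrite taua.
  rewrite /local_input; case: insubP => //= v _ vu; congr Some.
  have va : insub (val v) = None :> option {v0 : V | v0 \in [set a]%SET}.
    by rewrite insubN // inE [val v]vu.
  by rewrite !ffunE /local_input va.
set g := fAB _ _.
(* Both protocols use the same seed, so it suffices that every seed on which the simulation errs is
   one on which the network protocol errs. *)
suff sub w : two_errs g Q (size L) xA xB w ->
    net_errs G f P r x w.
  rewrite [leRHS](bigID [pred w | two_errs g Q (size L) xA xB w]) /=.
  rewrite [X in _ <= X + _](eq_bigl (fun w => two_errs g Q (size L) xA xB w))
    => [|w].
    by rewrite lerDl sumr_ge0 // => w _; exact: Defs.pmf_ge0.
  by case: (boolP (two_errs _ _ _ _ _ _)) => [/sub -> //|_]; rewrite andbF.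
have inv j : (j <= size L)%N ->
    let h := two_history Q w xA xB j in
    [/\ size h.1 = j, size h.2 = j, correct_bits G P sigma L w x h.1 &
        correct_bits G P tau L w x h.2].
  elim: j => [|j IH] jL; first by split.
  have {IH} := IH (ltnW jL).
  rewrite /=; case: (two_history Q w xA xB j) => ha hb /= [sa sb ca cb].
  (* Here [rho] is the horizon of the receiver and [rho'] that of the sender. If a slot crosses for
     the receiver, the receiver has lost its source vertex before round [r], so by [hcov] the sender
     knows that vertex throughout. *)
  have step rho rho' h h' (x' : inputs n K) : size h = j -> size h' = j ->
      (forall u, (0 < rho' u)%N -> local_input x' u = local_input x u) ->
      (forall s, crossing rho' s -> crossing tau s || crossing sigma s) ->
      (forall v, (r < rho v)%N || (r < rho' v)%N) ->
      correct_bits G P rho L w x h -> correct_bits G P rho' L w x h' ->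
      correct_bits G P rho L w x (rcons h (slot_bit G P rho' L w x' h')).
    move=> sh sh' hx hrho hcov ch ch' s sL.
    rewrite size_rcons sh ltnS leq_eqVlt nth_rcons sh.
    case: eqP => [ij _|_ /= ij]; last by rewrite ij => cr; apply: ch; rewrite ?sh.
    rewrite ij ltnn => cr.
    rewrite /slot_bit sh' -ij drop_index //; case: s sL ij cr => t [u v] sL ij cr /=.
    have tr : (t < r)%N by move: sL; rewrite mem_slots => /and3P[].
    have ru : (r < rho' u)%N.
      have := hcov u; case/andP: cr => /= ut _; rewrite ltnNge.
      by rewrite (leq_trans ut (ltnW tr)).
    rewrite /message hx ?(leq_ltn_trans _ ru) //.
    rewrite (@simulate_answers _ _ _ _ _ _ _ x x' tau sigma rho') ?(ltnW tr) //; last first.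
      exact: ltn_trans tr ru.
    move=> s' s'L; rewrite sh' => s't; apply: (slots_earlier (s0 := s')) => //.
    by rewrite -/L -ij nth_index.
  split; rewrite ?size_rcons ?sa ?sb //.
    apply: step => //; first by move=> s ->.
    by move=> v; rewrite orbC.
  by apply: step => // s ->; rewrite orbT.
have /= := inv _ (leqnn _).
rewrite /two_errs; case: (two_history Q w xA xB (size L)) => ha hb /= [sa sb ca cb].
have idx s h : size h = size L -> s \in L -> (s.1 < r)%N -> (index s L < size h)%N.
  by move=> -> sL _; rewrite index_mem.
rewrite (@simulate_answers _ _ _ _ _ _ _ x (xa xA) tau sigma sigma) //; first last.
- by move=> s sL; apply: idx.
- by move=> s ->; rewrite orbT.
rewrite (@simulate_answers _ _ _ _ _ _ _ x (xb xB) tau sigma tau) //; first last.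
- by move=> s sL; apply: idx.
- by move=> s ->.
rewrite hxa ?hxb ?(leq_ltn_trans _ siga) ?(leq_ltn_trans _ taub) // => e.
apply/existsP; case/orP: e => e; [exists a|exists b]; by apply/andP.
Qed.

(** * Hop-bounded distances *)

(** The codomain is general because both integer lengths and real weights are used. *)
Fixpoint path_length (V : finType) (M : nmodType) (y : {set V} -> M) (u : V)
    (p : seq V) : M :=
  if p is v :: q then y [set u; v]%SET + path_length y v q else 0.

Lemma path_length_cat (V : finType) (M : nmodType) (y : {set V} -> M) u p q :
  path_length y u (p ++ q) = path_length y u p + path_length y (last u p) q.
Proof. by elim: p u => [|v p IH] u /=; rewrite ?add0r // IH addrA. Qed.

Lemma path_length_rcons (V : finType) (M : nmodType) (y : {set V} -> M) u p v :
  path_length y u (rcons p v) = path_length y u p + y [set last u p; v]%SET.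
Proof. by rewrite -cats1 path_length_cat /= addr0. Qed.

Lemma path_length_rev (V : finType) (M : nmodType) (y : {set V} -> M) u p :
  path_length y (last u p) (rev (belast u p)) = path_length y u p.
Proof.
elim: p u => [|v p IH] u //=.
rewrite rev_cons path_length_rcons IH addrC; congr (y _ + _).
rewrite finset.setUC; congr [set _; _]%SET.
by case: p {IH} => [//|w p]; rewrite /= rev_cons last_rcons.
Qed.

Lemma sum_interval (r lo hi : nat) :
  (\sum_(t < r) ((lo <= t) && (t < hi)) <= minn r hi - lo)%N.
Proof.
elim: r => [|r IH]; first by rewrite big_ord0.
rewrite big_ord_recr /=; apply: leq_trans (leq_add IH (leqnn _)) _.
by case: (leqP lo r) => ? /=; case: (ltnP r hi) => ? /=; lia.
Qed.

(** [d] is the shortest-path distance from [a] for edge lengths [z + 1], capped at [D]. The cap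
    makes the minimum exist for unreachable vertices too. *)
Lemma distance_potential (V : finType) (G : sgraph V) (z : {set V} -> nat)
    (a : V) (D : nat) :
  exists d : V -> nat,
    [/\ d a = 0%N,
        forall u v, adj G u v -> (d v <= d u + (z [set u; v]%SET).+1)%N &
        forall v, (d v < D)%N -> exists p,
          [/\ path (adj G) a p, last a p = v &
              (path_length z a p + size p < D)%N]].
Proof.
pose W v m := (D <= m)%N \/ exists p,
  [/\ path (adj G) a p, last a p = v & (path_length z a p + size p <= m)%N].
have exW v : exists m, `[< W v m >] by exists D; apply/asboolP; left.
exists (fun v => ex_minn (exW v)); split.
- case: ex_minnP => m _ /(_ 0%N); rewrite leqn0 => h; apply/eqP/h/asboolP.
  by right; exists [::].
- move=> u v uv; case: (ex_minnP (exW u)) => m /asboolP hm _.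
  case: ex_minnP => m' _ /(_ (m + (z [set u; v]%SET).+1)%N); apply.
  apply/asboolP; case: hm => [Dm|[p [ap lp zp]]].
    by left; rewrite (leq_trans Dm) // leq_addr.
  right; exists (rcons p v); rewrite rcons_path ap last_rcons lp uv; split=> //.
  rewrite path_length_rcons lp size_rcons.
  have -> (i j : nat) : i + j = (i + j)%N by [].
  by lia.
- move=> v; case: ex_minnP => m /asboolP + _ mD.
  case=> [|[p [ap lp zp]]]; first by rewrite leqNgt mD.
  by exists p; split=> //; apply: leq_ltn_trans zp mD.
Qed.

(** * Well-linked terminals *)

Lemma sum_adj_edges (R : numDomainType) (V : finType) (G : sgraph V)
    (y : {set V} -> R) :
  (forall e, 0 <= y e) ->
  \sum_(p : V * V | adj G p.1 p.2) y [set p.1; p.2]%SET <=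
  2%:R * \sum_(e in edges G) y e.
Proof.
move=> y0.
rewrite (partition_big (fun p : V * V => [set p.1; p.2]%SET) (mem (edges G))) /=; last first.
  by move=> p hp; apply/imsetP; exists p.
rewrite mulr_sumr; apply: ler_sum => e /imsetP[[u v] /= uv ->].
rewrite (eq_bigr (fun=> y [set u; v]%SET)) => [|p /andP[_ /eqP -> //]].
rewrite sumr_const mulr_natl ler_wpMn2l //.
apply: (@leq_trans #|[set (u, v); (v, u)]%SET|); last by rewrite cards2; case: eqP.
apply/subset_leq_card/fintype.subsetP => -[s t] /= /andP[st /eqP E].
have su : s \in [set u; v]%SET by rewrite -E !inE eqxx.
have tu : t \in [set u; v]%SET by rewrite -E !inE eqxx orbT.
have nst : s != t by apply: contraTneq st => /= ->; rewrite adj_irrefl.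
rewrite !inE in su tu *; rewrite !xpair_eqE.
by case/orP: su nst => /eqP ->; case/orP: tu => /eqP ->; rewrite ?eqxx ?orbT.
Qed.

(** For [c > 0] this is, by linear programming duality, the existence of a fractional flow of value
    at least [1 / c] from [a] to [b] along paths of at most [h] edges, with unit edge capacities. *)
Definition well_linked (R : realType) (V : finType) (G : sgraph V) (K : {set V})
    (h : nat) (c : R) : Prop :=
  forall a b, a \in K -> b \in K -> a != b ->
  forall (y : {set V} -> R) (rho : R), (forall e, 0 <= y e) -> 0 < rho ->
    (forall p, path (adj G) a p -> last a p = b -> (size p <= h)%N ->
       rho <= path_length y a p) ->
    rho <= c * \sum_(e in edges G) y e.

(** In the constant, the factor [2r + 1] comes from rescaling [y] by [(2r + 1) / rho], and the
    factor 2 from counting each edge in both directions. *)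
Lemma well_linked_of_protocol (R : realType) (V : finType) (G : sgraph V)
    (K : {set V}) (n : nat) (f : inputs n K -> bool) (eps n' : R) (r : nat) :
  0 < n' -> net_computes G f eps r ->
  (forall a b : V, a \in K -> b \in K -> a != b ->
     exists xt : inputs n (K :\: ([set a] :|: [set b]))%SET,
       (n'%:E <= two_rounds eps
                   (fAB (A := [set a]%SET) (B := [set b]%SET) f xt))%E) ->
  well_linked G K r.*2 ((2 * r.*2.+1)%:R / n').
Proof.
move=> n0 hnet hard a b aK bK ab y rho y0 rho0 long.
have [xt hxt] := hard a b aK bK ab.
pose D := r.*2.+1; pose z e := Num.truncn (D%:R * y e / rho).
have yz0 e : 0 <= D%:R * y e / rho by rewrite divr_ge0 ?mulr_ge0 ?(ltW rho0).
have [d [da dadj dD]] := distance_potential G z a D.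
have db : (D <= d b)%N.
  rewrite leqNgt; apply/negP => /dD[p [ap lp pD]].
  have : rho <= path_length y a p by apply: long => //; move: pD; rewrite /D; lia.
  apply/negP; rewrite -ltNge.
  (* Rounding down loses less than 1 per edge, which the hop count compensates. A path of total
     length below [D] also has at most [2r] edges, so the assumption on [y] applies to it. *)
  have le u q : D%:R * path_length y u q / rho <= (path_length z u q + size q)%:R.
    elim: q u => [|v q IH] u /=.
      by rewrite mulr0 mul0r.
    have -> : (z [set u; v]%SET + path_length z v q + (size q).+1 =
      (z [set u; v]%SET).+1 + (path_length z v q + size q))%N.
      by lia.
    by rewrite natrD mulrDr mulrDl lerD // ltW // -truncn_le_nat.
  have {le} := le_lt_trans (le a p) (_ : _ < D%:R); rewrite ltr_nat => /(_ pD).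
  by rewrite ltr_pdivrMr // ltr_pM2l // ltr0n.
(* The uncapped horizons add up to at least [2r + 1], so one of them is at least [r + 1] and every
   vertex is covered. *)
pose tau v := minn r.+1 (d v); pose sigma v := minn r.+1 (D - d v).
have two : two_computes (fAB (A := [set a]%SET) (B := [set b]%SET) f xt) eps
    (size (slots G tau sigma r)).
  apply: (simulate xt aK bK) hnet; rewrite /tau /sigma ?da /D; lia.
have : n' <= (size (slots G tau sigma r))%:R.
  rewrite -lee_fin; apply: le_trans hxt _; apply: ereal_inf_lbound.
  by exists (size (slots G tau sigma r)).
rewrite mulrAC ler_pdivlMr // size_slots => hn.
have hslots : (\sum_(p : V * V | adj G p.1 p.2)
     \sum_(t < r) (crossing tau (val t, p) || crossing sigma (val t, p)) <=
     \sum_(p : V * V | adj G p.1 p.2) z [set p.1; p.2]%SET)%N.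
  apply: leq_sum => -[u v] /= uv.
  (* The crossing rounds on [(u, v)] form an interval. Along one orientation at most one of [tau]
     and [sigma] can increase by more than 1, so together they need at most [z] slots. *)
  have count (th : V -> nat) :
      (\sum_(t < r) crossing th (val t, (u, v)) <= (th v).-1 - th u)%N.
    apply: leq_trans (_ : _ <= \sum_(t < r) ((th u <= t) && (t < (th v).-1)))%N _.
      by apply: leq_sum => t _; rewrite /crossing /= ltn_predRL.
    by apply: leq_trans (sum_interval _ _ _) _; rewrite leq_sub2r // geq_minr.
  have vu : adj G v u by rewrite adj_sym.
  apply: leq_trans (_ : _ <= \sum_(t < r) crossing tau (val t, (u, v)) +
                             \sum_(t < r) crossing sigma (val t, (u, v)))%N _.
    by rewrite -big_split; apply: leq_sum => t _ /=; do 2 case: crossing.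
  apply: leq_trans (leq_add (count tau) (count sigma)) _.
  have := dadj _ _ uv; have := dadj _ _ vu.
  by rewrite [[set v; u]%SET]finset.setUC /tau /sigma; lia.
rewrite mulrC -ler_pdivlMr //.
apply: le_trans hn _.
apply: le_trans (_ : _ <= (\sum_(p : V * V | adj G p.1 p.2)
                            z [set p.1; p.2]%SET)%N%:R) _.
  by rewrite ler_nat.
rewrite natr_sum natrM -mulrA -mulrA.
apply: le_trans (_ : _ <= \sum_(p : V * V | adj G p.1 p.2)
                            D%:R * y [set p.1; p.2]%SET / rho) _.
  by apply: ler_sum => p _; rewrite /z truncn_le.
apply: le_trans (sum_adj_edges G yz0) _.
by rewrite -mulr_suml -mulr_sumr !mulrA.
Qed.

(** * Steiner trees *)

Lemma sub_adj_sym (V : finType) (F : {set {set V}}) : symmetric (sub_adj F).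
Proof. by move=> u v; rewrite /sub_adj finset.setUC. Qed.

Lemma dist_le_sym (V : finType) (e : rel V) (u v : V) (d : nat) :
  symmetric e -> dist_le e u v d -> dist_le e v u d.
Proof.
move=> esym [p [ep <- sp]]; exists (rev (belast u p)).
rewrite size_rev size_belast; split=> //.
  by rewrite (eq_path (e' := fun x => e^~ x)) ?rev_path.
by case: p {ep sp} => [//|w p]; rewrite /= rev_cons last_rcons.
Qed.

Lemma dist_le_trans (V : finType) (e : rel V) (u v w : V) (d d' : nat) :
  dist_le e u v d -> dist_le e v w d' -> dist_le e u w (d + d').
Proof.
move=> [p [ep <- sp]] [q [eq <- sq]]; exists (p ++ q).
by rewrite cat_path ep eq last_cat size_cat leq_add.
Qed.

Lemma dist_le_connect (V : finType) (e : rel V) (u v : V) (d : nat) :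
  dist_le e u v d -> connect e u v.
Proof. by move=> [p [ep <- _]]; apply/connectP; exists p. Qed.

Lemma dist_le_card (V : finType) (e : rel V) (u v : V) (d : nat) :
  dist_le e u v d -> dist_le e u v (minn d #|V|).
Proof.
move=> [p [ep <- sp]]; case/shortenP: ep => q eq uq qp; exists q; split=> //.
rewrite leq_min; apply/andP; split; last first.
  by apply: ltnW; apply: leq_trans (max_card (mem (u :: q))); rewrite (card_uniqP uq).
by apply: leq_trans sp; apply: uniq_leq_size => //; case/andP: uq.
Qed.

Lemma mono_dist_le (V : finType) (F F' : {set {set V}}) (u v : V) (d d' : nat) :
  F \subset F' -> (d <= d')%N ->
  dist_le (sub_adj F) u v d -> dist_le (sub_adj F') u v d'.
Proof.
move=> /fintype.subsetP FF dd [p [ep lp sp]]; exists p; split=> //.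
  by apply: sub_path ep => x y; apply: FF.
exact: leq_trans dd.
Qed.

Lemma sub_adj_neq (V : finType) (G : sgraph V) (F : {set {set V}}) u v :
  F \subset edges G -> sub_adj F u v -> u != v.
Proof.
move=> /fintype.subsetP FG /FG /imsetP[[s t] /= st E].
apply: contraTneq st => uv /=.
have := cards2 s t; rewrite -E uv finset.setUid cards1.
by case: eqP => // ->; rewrite inE /= adj_irrefl.
Qed.

(** Joining each vertex reachable from [r0] to a breadth-first parent keeps distances to the root;
    any two terminals are then at most [h + h] apart via the root. *)
Lemma shallow_steiner_tree (V : finType) (G : sgraph V) (K : {set V})
    (F : {set {set V}}) (r0 : V) (h : nat) :
  F \subset edges G ->
  (forall a, a \in K -> dist_le (sub_adj F) r0 a h) ->
  exists2 T : subgraph V, is_steiner_tree G K (h + h) T & T.2 \subset F.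
Proof.
move=> FG Kh; pose e := sub_adj F.
have [dist distP] : exists dist : V -> nat, forall v, connect e r0 v ->
    dist_le e r0 v (dist v) /\ forall d, dist_le e r0 v d -> (dist v <= d)%N.
  have ex v : exists d, connect e r0 v ->
      dist_le e r0 v d /\ forall d', dist_le e r0 v d' -> (d <= d')%N.
    have [/connectP[p ep lp]|_] := boolP (connect e r0 v); last by exists 0%N.
    have ex : exists d, `[< dist_le e r0 v d >].
      by exists (size p); apply/asboolP; exists p.
    exists (ex_minn ex) => _; case: ex_minnP => d /asboolP hd dmin.
    by split=> // d' hd'; apply/dmin/asboolP.
  by exists (fun v => projT1 (cid (ex v))) => v; case: cid.
have [parent parentP] : exists parent : V -> V, forall v,
    connect e r0 v -> v != r0 ->
    [/\ connect e r0 (parent v), e (parent v) v & dist v = (dist (parent v)).+1].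
  have ex v : exists u, connect e r0 v -> v != r0 ->
      [/\ connect e r0 u, e u v & dist v = (dist u).+1].
    have [cv|_] := boolP (connect e r0 v); last by exists v.
    have [->|vr] := eqVneq v r0; first by exists r0; rewrite ?eqxx.
    have [[p [ep lp sp]] dmin] := distP v cv.
    case/lastP: p ep lp sp => [_ /= rv|p w]; first by rewrite rv eqxx in vr.
    rewrite rcons_path last_rcons size_rcons => /andP[ep ew] wv sp.
    exists (last r0 p) => _ _; rewrite -wv.
    have cu : connect e r0 (last r0 p) by apply/connectP; exists p.
    split=> //; have [du dumin] := distP _ cu; rewrite wv.
    apply/eqP; rewrite eqn_leq; apply/andP; split.
      apply: dmin; have [q [eq lq sq]] := du; exists (rcons q w).
      by rewrite rcons_path eq lq ew last_rcons size_rcons.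
    by apply: leq_trans sp; rewrite ltnS; apply: dumin; exists p.
  by exists (fun v => projT1 (cid (ex v))) => v; case: cid.
pose TV := [set v | connect e r0 v]%SET.
pose TE := [set [set parent v; v]%SET | v in [set v in TV | v != r0]%SET]%SET.
have TEF : TE \subset F.
  apply/fintype.subsetP => _ /imsetP[v + ->]; rewrite !inE => /andP[cv vr].
  by have [] := parentP v cv vr.
have TEP u v : sub_adj TE u v ->
    (u = parent v /\ dist v = (dist u).+1) \/ (v = parent u /\ dist u = (dist v).+1).
  move=> uv; have uNv := sub_adj_neq (fintype.subset_trans TEF FG) uv.
  case/imsetP: uv => w; rewrite !inE => /andP[cw wr] E.
  have [_ _ dw] := parentP w cw wr.
  have : u \in [set parent w; w]%SET by rewrite -E !inE eqxx.
  have : v \in [set parent w; w]%SET by rewrite -E !inE eqxx orbT.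
  rewrite !inE => /orP[] /eqP vw /orP[] /eqP uw; subst u v.
  - by rewrite eqxx in uNv.
  - by right.
  - by left.
  - by rewrite eqxx in uNv.
have Tdist v : connect e r0 v -> dist_le (sub_adj TE) r0 v (dist v).
  have [m] := ubnP (dist v); elim: m v => // m IH v dm cv.
  have [->|vr] := eqVneq v r0; first by exists [::].
  have [cu eu du] := parentP v cv vr.
  have [|q [eq lq sq]] := IH (parent v) _ cu; first by rewrite -ltnS -du.
  exists (rcons q v); rewrite rcons_path eq lq last_rcons size_rcons du ltnS.
  by split=> //=; apply: imset_f; rewrite !inE cv.
have csym := sym_connect_sym (@sub_adj_sym _ TE).
have Kc a : a \in K -> connect e r0 a by move=> /Kh /dist_le_connect.
exists (TV, TE) => //; split=> /=.
- split=> /=.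
  + by apply/set0Pn; exists r0; rewrite inE.
  + exact: fintype.subset_trans TEF FG.
  + move=> _ /imsetP[v + ->]; rewrite !inE => /andP[cv vr].
    have [cu _ _] := parentP v cv vr.
    by apply/fintype.subsetP => w; rewrite !inE => /orP[] /eqP ->.
  + move=> u v; rewrite !inE => /Tdist/dist_le_connect cu /Tdist/dist_le_connect.
    by apply: connect_trans; rewrite csym.
  + move=> c /andP[cyc uc]; rewrite ltnNge; apply/negP => sc.
    have [v0 v0c] : exists v, v \in c.
      by case: c sc {cyc uc} => // v c; exists v; rewrite inE eqxx.
    (* On a cycle, both neighbours of a deepest vertex must be its parent, which is impossible when
       the cycle has at least three distinct vertices. *)
    pose v := [arg max_(v > v0 | v \in c) dist v]%N.
    have [vc vmax] : v \in c /\ forall u, u \in c -> (dist u <= dist v)%N.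
      by rewrite /v; case: arg_maxnP.
    have [i s E] := rot_to vc.
    have nb u : sub_adj TE v u -> u \in c -> u = parent v.
      move=> vu uc'; case: (TEP _ _ vu) => [[_ du]|[]] //.
      by have := vmax u uc'; rewrite du ltnn.
    move: cyc uc sc; rewrite -(rot_cycle i) -(rot_uniq i) -(size_rot i) E /=.
    have sub u : u \in s -> u \in c by move=> us; rewrite -(mem_rot i c) E inE us orbT.
    case: s E sub => [//|x s] E sub; case/lastP: s E sub => [//|s z] E sub.
    have xc : x \in c by apply: sub; rewrite inE eqxx.
    have zc : z \in c by apply: sub; rewrite inE mem_rcons inE eqxx orbT.
    rewrite -cats1 /= cat_path /= last_rcons => /and3P[vx _ /andP[zv _]].
    rewrite sub_adj_sym in zv; rewrite (nb x vx xc) (nb z zv zc).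
    by rewrite mem_rcons inE eqxx /= andbF.
- apply/fintype.subsetP => a /Kc; rewrite inE //.
- move=> u v uK vK.
  have d a : a \in K -> dist_le (sub_adj TE) r0 a h.
    move=> aK; have := Tdist _ (Kc _ aK); apply: mono_dist_le => //.
    by have [_] := distP _ (Kc _ aK); apply; apply: Kh.
  apply: dist_le_trans (d _ vK); apply: dist_le_sym (d _ uK).
  exact: sub_adj_sym.
Qed.

(** * Linking the terminals *)

(** A maximal independent set of the graph of [nxt] dominates by maximality, and its complement in
    [K] dominates by independence. The smaller of the two has at most half the elements. *)
Lemma dominating_half (V : finType) (K : {set V}) (nxt : V -> V) :
  (0 < #|K|)%N ->
  (forall a, a \in K -> nxt a \in K /\ nxt a != a) ->
  exists K' : {set V}, [/\ K' \subset K, (0 < #|K'|)%N, (#|K'|.*2 <= #|K|)%N &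
    forall a, a \in K -> a \notin K' ->
      nxt a \in K' \/ exists2 c, c \in K' & nxt c = a].
Proof.
move=> K0 hnxt.
pose indep (S : {set V}) := (S \subset K) && [forall a in S, nxt a \notin S].
have [S /maxsetP[/andP[SK /forall_inP Sind] Smax] _] :
    {S | maxset indep S & finset.set0 \subset S}.
  apply: maxset_exists; rewrite /indep finset.sub0set; apply/forall_inP => a; by rewrite inE.
have half (S' : {set V}) : S' \subset K -> (forall a, a \in K -> a \notin S' ->
      nxt a \in S' \/ exists2 c, c \in S' & nxt c = a) -> (0 < #|S'|)%N.
  move=> S'K dom; have /fintype.card_gt0P[a aK] := K0; apply/fintype.card_gt0P.
  have [aS|aS] := boolP (a \in S'); first by exists a.
  by case: (dom a aK aS) => [?|[c ?] _]; [exists (nxt a)|exists c].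
have domS a : a \in K -> a \notin S ->
      nxt a \in S \/ exists2 c, c \in S & nxt c = a.
  move=> aK aS; apply: contrapT => /not_orP[n1 n2].
  suff : indep (a |: S)%SET.
    move=> /Smax; rewrite finset.subsetUr => /(_ isT) E.
    by rewrite -E !inE eqxx in aS.
  rewrite /indep finset.subUset finset.sub1set aK SK /=; apply/forall_inP => c.
  have [nK na] := hnxt a aK.
  rewrite !inE => /orP[/eqP ->|cS]; rewrite negb_or.
    by rewrite na; apply/negP.
  by rewrite Sind // andbT; apply/eqP => nc; apply: n2; exists c.
have domSC a : a \in K -> a \notin (K :\: S)%SET ->
      nxt a \in (K :\: S)%SET \/ exists2 c, c \in (K :\: S)%SET & nxt c = a.
  move=> aK; rewrite !inE aK andbT negbK => aS; left.
  by rewrite Sind //=; have [] := hnxt a aK.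
have cK : (#|S| + #|(K :\: S)%SET| = #|K|)%N by rewrite -(cardsID S K) (finset.setIidPr SK).
have [le|lt] := leqP #|S|.*2 #|K|.
  by exists S; split=> //; apply: half.
exists (K :\: S)%SET; split=> //; first exact: finset.subsetDl.
  by apply: half => //; exact: finset.subsetDl.
by lia.
Qed.

(** Without such a path, zero weights and [rho = 1] would satisfy the premise vacuously and give
    [1 <= 0]. *)
Lemma well_linked_path (R : realType) (V : finType) (G : sgraph V) (K : {set V})
    (h : nat) (c : R) a b :
  well_linked G K h c -> a \in K -> b \in K -> a != b ->
  exists p, [/\ path (adj G) a p, last a p = b & (size p <= h)%N].
Proof.
move=> wl aK bK ab; apply: contrapT => nop.
have := wl a b aK bK ab (fun=> 0) 1 (fun=> lexx 0) ltr01.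
rewrite big1 // mulr0 ler10 => H; suff : false by [].
by apply: H => p ap lp sp; case: nop; exists p.
Qed.

(** The factor 4 is the product of 2 for the balls having half the link length as radius, and 2 for
    an edge having two ends, each in at most one ball. *)
Lemma linking_paths (R : realType) (V : finType) (G : sgraph V) (K K' : {set V})
    (h : nat) (c : R) (y : {set V} -> R) :
  well_linked G K h c -> 0 <= c -> (forall e, 0 <= y e) ->
  K' \subset K -> (1 < #|K'|)%N ->
  exists lnk : V -> seq V,
    (forall a, a \in K' ->
       [/\ path (adj G) a (lnk a), (size (lnk a) <= h.*2)%N,
           last a (lnk a) \in K' & last a (lnk a) != a]) /\
    \sum_(a in K') path_length y a (lnk a) <= 4 * c * \sum_(e in edges G) y e.
Proof.
move=> wl c0 y0 /fintype.subsetP K'K K'1.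
pose good a (p : seq V) :=
  [&& path (adj G) a p, (size p <= h.*2)%N, last a p \in K' & last a p != a].
have other a : a \in K' -> exists2 b, b \in K' & b != a.
  move=> aK'; have : (0 < #|K' :\ a|%SET)%N by rewrite (cardsD1 a) aK' in K'1.
  by move/fintype.card_gt0P => [b]; rewrite !inE => /andP[ba bK']; exists b.
have [lnk lnkP] : exists lnk : V -> seq V, forall a, a \in K' -> good a (lnk a) /\
    forall p, good a p -> path_length y a (lnk a) <= path_length y a p.
  have ex a : exists q, a \in K' -> good a q /\
      forall p, good a p -> path_length y a q <= path_length y a p.
    have [aK'|] := boolP (a \in K'); last by exists [::].
    have [b bK' ba] := other a aK'.
    have [|p [ap lp sp]] := well_linked_path wl (K'K _ aK') (K'K _ bK').
      by rewrite eq_sym.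
    have sp2 : (size p <= h.*2)%N by rewrite -addnn (leq_trans sp) // leq_addr.
    (* Sequences of bounded size form a finite type, so a cheapest good path exists. *)
    pose q0 : h.*2.-bseq V := Bseq sp2.
    have gq0 : good a q0 by rewrite /good ap sp2 lp bK' ba.
    pose q := [arg min_(q < q0 | good a q) path_length y a q]%O.
    exists q => _; rewrite /q; case: Order.TotalTheory.arg_minP => // q1 gq1 q1min.
    split=> // p1 gp1; have sp1 : (size p1 <= h.*2)%N by case/and4P: gp1.
    exact: (q1min (Bseq sp1)).
  by exists (fun v => projT1 (cid (ex v))) => v; case: cid.
exists lnk; split; first by move=> a /lnkP[/and4P[]].
pose s a := path_length y a (lnk a).
pose ball a := [set v | `[< exists p, [/\ path (adj G) a p, last a p = v,
  (size p <= h)%N & path_length y a p < s a / 2] >]]%SET.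
pose ya a (e : {set V}) := if [exists v in ball a, v \in e] then y e else 0.
have ya0 a (e : {set V}) : 0 <= ya a e by rewrite /ya; case: ifP.
(* Two paths meeting at [v] combine into one of at most [2h] edges and length below
   [(s a + s b) / 2]. It is a candidate link for both [a] and [b], hence at least as long as either
   link. *)
have disj v a b : a \in K' -> b \in K' -> v \in ball a -> v \in ball b -> a = b.
  move=> aK' bK'; rewrite !finset.in_set.
  move=> /asboolP[p [ap lp sp yp]] /asboolP[q [bq lq sq yq]].
  apply/eqP; apply: contraT => ab.
  pose w := p ++ rev (belast b q).
  have lrev : last v (rev (belast b q)) = b.
    rewrite -lq; case: (q) => [//|x q']; by rewrite /= rev_cons last_rcons.
  have prev : path (adj G) v (rev (belast b q)).
    by rewrite -lq (eq_path (e' := fun x => (adj G)^~ x)) ?rev_path //; apply: adj_sym.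
  have lw : last a w = b by rewrite last_cat lp.
  have aw : path (adj G) a w by rewrite cat_path ap lp.
  have sw : (size w <= h.*2)%N by rewrite size_cat size_rev size_belast -addnn leq_add.
  have yw : path_length y a w = path_length y a p + path_length y b q.
    by rewrite path_length_cat lp -lq path_length_rev.
  have sa : s a <= path_length y a w.
    by apply: (lnkP a aK').2; rewrite /good aw sw lw bK' eq_sym ab.
  have sb : s b <= path_length y a w.
    rewrite -(path_length_rev y a w) lw; apply: (lnkP b bK').2; rewrite /good.
    have -> : last b (rev (belast a w)) = a.
      rewrite -[in X in last X]lw; case: (w) => [//|x q']; by rewrite /= rev_cons last_rcons.
    rewrite size_rev size_belast sw aK' ab !andbT -lw.
    by rewrite (eq_path (e' := fun x => (adj G)^~ x)) ?rev_path //; apply: adj_sym.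
  by move: sa sb yp yq; rewrite yw; lra.
have volume a : a \in K' -> s a <= 2 * c * \sum_(e in edges G) ya a e.
  move=> aK'; have [sa0|sa0] := leP (s a) 0.
    by apply: le_trans sa0 _; rewrite !mulr_ge0 // sumr_ge0.
  have [b bK' ba] := other a aK'.
  have ab : a != b by rewrite eq_sym.
  suff : s a / 2 <= c * \sum_(e in edges G) ya a e by lra.
  apply: (wl a b (K'K _ aK') (K'K _ bK') ab) => //; first by lra.
  move=> p ap lp sp.
  have : s a <= path_length y a p.
    apply: (lnkP a aK').2; rewrite /good ap lp bK' ba !andbT /=.
    by rewrite -addnn (leq_trans sp) // leq_addr.
  (* By induction on prefixes: as long as the length is below [s a / 2], the end of the prefix lies
     in the ball, so the next edge keeps its full weight in [ya a]. *)
  suff : Num.min (path_length y a p) (s a / 2) <= path_length (ya a) a p.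
    by rewrite ge_min => /orP[|] ?; lra.
  elim/last_ind: p ap sp {lp} => [|p v IH]; first by rewrite /= ge_min lexx.
  rewrite rcons_path size_rcons => /andP[ap _] sp; have {IH} := IH ap (ltnW sp).
  rewrite !path_length_rcons !ge_min.
  have ge0 := ya0 a [set last a p; v]%SET.
  have [le|lt] := leP (s a / 2) (path_length y a p).
    by move=> h1; apply/orP; right; case/orP: h1 => h1; lra.
  have -> : ya a [set last a p; v]%SET = y [set last a p; v]%SET.
    rewrite /ya ifT //; apply/existsP; exists (last a p); rewrite !inE eqxx !andbT.
    by apply/asboolP; exists p; split=> //; apply: ltnW.
  by move=> h1; apply/orP; left; case/orP: h1 => h1; lra.
apply: le_trans (ler_sum _ volume) _.
rewrite -mulr_sumr exchange_big /=.
have -> : 4 * c * \sum_(e in edges G) y e = 2 * c * \sum_(e in edges G) (y e *+ 2).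
  by rewrite sumrMnl; lra.
rewrite ler_wpM2l ?mulr_ge0 //; apply: ler_sum => e eG.
have -> : y e *+ 2 = \sum_(x in e) y e.
  by rewrite sumr_const; case/imsetP: eG => -[u v] /= uv ->; rewrite cards2;
     case: eqP uv => // ->; rewrite inE /= adj_irrefl.
apply: le_trans (_ : _ <= \sum_(a in K') \sum_(x in e) (if x \in ball a then y e else 0)) _.
  apply: ler_sum => a aK'; rewrite /ya; case: ifP => [/existsP[x /andP[xa xe]]|_].
    rewrite (bigD1 x) //= xa lerDl sumr_ge0 // => x' _; by case: ifP.
  by apply: sumr_ge0 => x _; case: ifP.
rewrite exchange_big /=; apply: ler_sum => x xe.
have [[a aK' xa]|none] := pselect (exists2 a, a \in K' & x \in ball a).
  rewrite (bigD1 a) //= xa big1 ?addr0 // => b /andP[bK' ba].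
  by case: ifP => // xb; rewrite (disj x b a) ?eqxx in ba.
rewrite big1 // => a aK'; case: ifP => // xa; by case: none; exists a.
Qed.

(** * Shallow subgraphs of small weight *)

Fixpoint path_edges (V : finType) (u : V) (p : seq V) : {set {set V}} :=
  if p is v :: q then ([set u; v]%SET |: path_edges v q)%SET else finset.set0.

Lemma path_edges_sub (V : finType) (G : sgraph V) u p :
  path (adj G) u p -> path_edges u p \subset edges G.
Proof.
elim: p u => [|v p IH] u /=; first by rewrite finset.sub0set.
case/andP=> uv /IH vp; rewrite finset.subUset vp andbT finset.sub1set.
by apply/imsetP; exists (u, v).
Qed.

Lemma path_sub_adj (V : finType) (F : {set {set V}}) u p :
  path_edges u p \subset F -> path (sub_adj F) u p.
Proof.
elim: p u => [|v p IH] u //=.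
by rewrite finset.subUset finset.sub1set => /andP[uv /IH ->]; rewrite andbT.
Qed.

Lemma sum_setU_le (R : numDomainType) (I : finType) (A B : {set I}) (y : I -> R) :
  (forall i, 0 <= y i) ->
  \sum_(i in (A :|: B)%SET) y i <= \sum_(i in A) y i + \sum_(i in B) y i.
Proof.
move=> y0; rewrite (big_setID A) /= finset.setUK lerD2l.
rewrite [leRHS](big_setID A) /= finset.setDUl finset.setDv finset.set0U lerDr.
by rewrite sumr_ge0.
Qed.

Lemma sum_bigcup_le (R : numDomainType) (I J : finType) (K : {set J})
    (A : J -> {set I}) (y : I -> R) :
  (forall i, 0 <= y i) ->
  \sum_(i in \bigcup_(a in K) A a) y i <= \sum_(a in K) \sum_(i in A a) y i.
Proof.
move=> y0; elim/big_rec2: _ => [|a s X _ IH]; first by rewrite big_set0.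
by apply: le_trans (sum_setU_le _ _ y0) _; rewrite lerD2l.
Qed.

Lemma sum_path_edges_le (R : numDomainType) (V : finType) (y : {set V} -> R) u p :
  (forall e, 0 <= y e) -> \sum_(e in path_edges u p) y e <= path_length y u p.
Proof.
move=> y0; elim: p u => [|v p IH] u /=; first by rewrite big_set0.
by apply: le_trans (sum_setU_le _ _ y0) _; rewrite big_set1 lerD2l.
Qed.

(** Induction on the number [j] of halving phases: each phase adds one system of links to the weight
    and one link, of at most [2h] edges, to the depth. *)
Lemma shallow_light_subgraph (R : realType) (V : finType) (G : sgraph V)
    (K : {set V}) (h : nat) (c : R) (y : {set V} -> R) (j : nat) (K' : {set V}) :
  well_linked G K h c -> 0 <= c -> (forall e, 0 <= y e) ->
  K' \subset K -> (0 < #|K'| <= 2 ^ j)%N ->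
  exists r0 : V, exists F : {set {set V}},
    [/\ r0 \in K', F \subset edges G,
        \sum_(e in F) y e <= j%:R * (4 * c * \sum_(e in edges G) y e) &
        forall a, a \in K' -> dist_le (sub_adj F) r0 a (j * h.*2)].
Proof.
move=> wl c0 y0; elim: j K' => [|j IH] K' K'K /andP[K'0 K'j].
  have /cards1P[r0 ->] : #|K'| == 1%N by rewrite eqn_leq K'0 K'j.
  exists r0, finset.set0; rewrite !inE eqxx finset.sub0set big_set0 mul0r.
  by split=> // a; rewrite inE => /eqP ->; exists [::].
have Y0 : 0 <= 4 * c * \sum_(e in edges G) y e by rewrite !mulr_ge0 // sumr_ge0.
have [K'1|K'1] := leqP #|K'| 1.
  have [|r0 [F [r0K FG Fy Fd]]] := IH K' K'K.
    by rewrite K'0 (leq_trans K'1) // expn_gt0.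
  exists r0, F; split=> //; first by apply: le_trans Fy _; rewrite ler_wpM2r // ler_nat.
  by move=> a /Fd; apply: mono_dist_le => //; rewrite leq_mul2r leqnSn orbT.
have [lnk [lnkP lnky]] := linking_paths wl c0 y0 K'K K'1.
have [a aK'|K'' [K''K' K''0 half dom]] := @dominating_half V K' (fun a => last a (lnk a)) K'0.
  by have [] := lnkP a aK'.
have [||r0 [F [r0K FG Fy Fd]]] := IH K''.
- exact: fintype.subset_trans K''K' K'K.
- by rewrite K''0 -leq_double (leq_trans half) // -mul2n -expnS.
pose F' := (F :|: \bigcup_(a in K') path_edges a (lnk a))%SET.
have FF' : F \subset F' := finset.subsetUl _ _.
have lnkF' a : a \in K' -> dist_le (sub_adj F') a (last a (lnk a)) h.*2.
  move=> aK'; exists (lnk a); have [_ sl _ _] := lnkP a aK'; split=> //.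
  apply: path_sub_adj; apply: finset.subsetU; apply/orP; right.
  exact: (finset.bigcup_sup a).
exists r0, F'; split.
- exact: (fintype.subsetP K''K').
- rewrite finset.subUset FG; apply/finset.bigcupsP => a aK'.
  by apply: path_edges_sub; have [] := lnkP a aK'.
- apply: le_trans (sum_setU_le _ _ y0) _; rewrite -natr1 mulrDl mul1r lerD //.
  apply: le_trans (sum_bigcup_le _ _ y0) _; apply: le_trans lnky.
  by apply: ler_sum => a _; apply: sum_path_edges_le.
- move=> a aK'.
  (* A dropped terminal reaches a kept one by its own link, or by the reverse of a link ending at
     it. *)
  have via c' : c' \in K'' -> dist_le (sub_adj F') c' a h.*2 ->
      dist_le (sub_adj F') r0 a (j.+1 * h.*2).
    move=> c'K d; rewrite mulSn addnC; apply: dist_le_trans d.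
    exact: mono_dist_le (Fd _ c'K).
  have [aK''|aK''] := boolP (a \in K''); first by apply: (via a) => //; exists [::].
  have [nK|[c' c'K nc]] := dom a aK' aK''.
    by apply: via nK _; apply: dist_le_sym (@sub_adj_sym _ _) (lnkF' a aK').
  have := lnkF' c' (fintype.subsetP K''K' _ c'K); rewrite [last _ _]nc; exact: via.
Qed.

(** * Fractional packing *)

(** Give [e] the weight [2 ^+ load]. Adding a cheap [T] doubles the weights of its elements and so
    multiplies the total by at most [1 + kappa]. After [N] rounds every load is at most
    [(ln #|B| + kappa N) / ln 2], and dividing the counts by a bound on this gives the packing. *)
Lemma fractional_packing (R : realType) (S E : finType) (A : {set S})
    (B : {set E}) (inc : E -> S -> bool) (kappa : R) :
  0 < kappa ->
  (forall y : E -> R, (forall e, 0 <= y e) -> exists2 T, T \in A &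
     \sum_(e in B | inc e T) y e <= kappa * \sum_(e in B) y e) ->
  exists z : S -> R, [/\ forall T, 0 <= z T,
    forall e, e \in B -> \sum_(T in A | inc e T) z T <= 1 &
    \sum_(T in A) z T = ln 2 / (2 * kappa)].
Proof.
move=> k0 cheap.
pose load (cnt : S -> nat) e := (\sum_(T in A | inc e T) cnt T)%N.
have greedy N : exists cnt : S -> nat, (\sum_(T in A) cnt T)%N = N /\
    \sum_(e in B) 2 ^+ load cnt e <= #|B|%:R * (1 + kappa) ^+ N.
  elim: N => [|N [cnt [cN hcnt]]].
    exists (fun=> 0%N); rewrite big1 // expr0 mulr1; split=> //.
    by rewrite (eq_bigr (fun=> 1)) ?sumr_const // /load => e _; rewrite big1.
  have [|T0 T0A hT0] := cheap (fun e => 2 ^+ load cnt e).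
    by move=> e; rewrite exprn_ge0.
  exists (fun T => cnt T + (T == T0))%N; split.
    rewrite big_split /= cN (bigD1 T0) //= eqxx big1 ?addn0 ?addn1 //.
    by move=> T /andP[_ /negPf ->].
  have loadE e : load (fun T => cnt T + (T == T0))%N e = (load cnt e + inc e T0)%N.
    rewrite /load big_split /=; congr (_ + _)%N.
    rewrite big_mkcondr (bigD1 T0) //= eqxx big1 ?addn0; first by case: (inc _ _).
    by move=> T /andP[_ /negPf ->]; case: (inc _ _).
  rewrite (eq_bigr (fun e => 2 ^+ load cnt e +
             (if inc e T0 then 2 ^+ load cnt e else 0))); last first.
    move=> e _; rewrite loadE; case: (inc _ _); last by rewrite addn0 addr0.
    by rewrite addn1 exprS mulr2n mulrDl mul1r.
  rewrite big_split /= -big_mkcondr exprS mulrCA mulrDl mul1r.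
  apply: lerD => //; apply: le_trans hT0 _; by rewrite ler_wpM2l // ltW.
(* With [N] this large, [ln #|B|] is at most [kappa N], so loads are at most [b] and the value
   [N / b] does not depend on [#|B|]. The successor also keeps [N] positive. *)
pose N := (Num.truncn (ln #|B|%:R / kappa)).+1.
have [cnt [cN hcnt]] := greedy N.
have N0 : 0 < N%:R :> R by rewrite ltr0n.
have ln20 : 0 < ln 2 :> R by rewrite ln_gt0 // ltr1n.
pose b : R := 2 * kappa * N%:R / ln 2.
have b0 : 0 < b by rewrite divr_gt0 // !mulr_gt0.
exists (fun T => (cnt T)%:R / b); split.
- by move=> T; rewrite divr_ge0 // ltW.
- move=> e eB; rewrite -mulr_suml ler_pdivrMr // mul1r -natr_sum -/(load cnt e).
  rewrite /b ler_pdivlMr //.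
  have cB : 0 < #|B|%:R :> R by rewrite ltr0n card_gt0; apply/set0Pn; exists e.
  have pk : 0 < 1 + kappa by rewrite addr_gt0.
  have : 2 ^+ load cnt e <= #|B|%:R * (1 + kappa) ^+ N :> R.
    apply: le_trans hcnt; rewrite (bigD1 e) //= lerDl sumr_ge0 //.
  rewrite -ler_ln ?posrE ?exprn_gt0 ?mulr_gt0 ?exprn_gt0 //.
  rewrite lnM ?posrE ?exprn_gt0 // !lnXn // -[ln 2 *+ _]mulr_natl.
  rewrite -[_ *+ N]mulr_natl => le3; apply: le_trans le3 _.
  have le1 : ln #|B|%:R <= kappa * N%:R.
    by rewrite mulrC -ler_pdivrMr // ltW // truncnS_gt.
  have le2 : N%:R * ln (1 + kappa) <= kappa * N%:R.
    by rewrite mulrC ler_pM2r // le_ln1Dx // (lt_trans _ k0) // ltrN10.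
  by apply: le_trans (lerD le1 le2) _; lra.
- rewrite -mulr_suml -natr_sum cN /b.
  by rewrite invf_div mulrCA; congr (_ * _); rewrite invfM mulrCA divff ?mulr1 // gt_eqF.
Qed.

(** The diameter is twice the depth [j * h.*2]. It may be capped at [#|V|] because paths can be
    shortened to simple ones. *)
Lemma cheap_steiner_tree (R : realType) (V : finType) (G : sgraph V)
    (K : {set V}) (h j : nat) (c : R) (y : {set V} -> R) :
  well_linked G K h c -> 0 <= c -> (0 < #|K| <= 2 ^ j)%N ->
  (forall e, 0 <= y e) ->
  exists2 T, T \in steiner_trees G K (minn (2 * (j * h.*2)) #|V|) &
    \sum_(e in edges G | e \in T.2) y e <=
    (4 * j%:R * c) * \sum_(e in edges G) y e.
Proof.
move=> wl c0 Kj y0.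
have [r0 [F [r0K FG Fy Fd]]] := shallow_light_subgraph wl c0 y0 (fintype.subxx K) Kj.
have [T [Ttree KT Td] TF] := shallow_steiner_tree FG Fd.
exists T.
  rewrite finset.in_set; apply/asboolP; split=> // u v uK vK.
  by apply: dist_le_card; rewrite mul2n -addnn; apply: Td.
apply: le_trans (_ : _ <= \sum_(e in F) y e) _.
  rewrite [leLHS]big_mkcond [leRHS]big_mkcond /=; apply: ler_sum => e _.
  case: ifP => [/andP[_ /(fintype.subsetP TF) -> //]|_]; by case: ifP.
by apply: le_trans Fy _; lra.
Qed.

Lemma ST_ge (R : realType) (V : finType) (G : sgraph V)
    (K : {set V}) (h j : nat) (c : R) :
  well_linked G K h c -> 0 < c -> (0 < j)%N -> (0 < #|K| <= 2 ^ j)%N ->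
  ((ln 2 / (8 * j%:R * c))%:E <= ST R G K (minn (2 * (j * h.*2)) #|V|))%E.
Proof.
move=> wl c0 j0 Kj; set D := minn _ _.
have k0 : 0 < 4 * j%:R * c by rewrite !mulr_gt0 // ltr0n.
have [|z [z0 zB zS]] := @fractional_packing R (subgraph V) {set V}
  (steiner_trees G K D) (edges G) (fun e T => e \in T.2) _ k0.
  by move=> y y0; apply: cheap_steiner_tree => //; apply: ltW.
apply: ereal_sup_ubound; exists z; first by split=> // T _.
by rewrite zS; congr ((_ / _)%:E); lra.
Qed.

(** * The round lower bound *)

Lemma trunc_logS_le_ln (R : realType) (m k : nat) :
  (1 < m)%N -> (m <= k)%N ->
  (trunc_log 2 m).+1%:R <= 2 * ln (k%:R : R) / ln 2.
Proof.
move=> m1 mk; have ln20 : 0 < ln 2 :> R by rewrite ln_gt0 // ltr1n.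
set t := trunc_log 2 m.
(* Since [t] is at least 1, the rounding up [t + 1] is at most [2 t]. *)
have t1 : (0 < t)%N by rewrite trunc_log_gt0.
have : t%:R * ln 2 <= ln (k%:R : R).
  rewrite mulr_natl -lnXn // ler_ln ?posrE ?exprn_gt0 //; last first.
    by rewrite ltr0n (leq_trans _ mk) // ltnW.
  rewrite -natrX ler_nat (leq_trans _ mk) //.
  by apply: trunc_logP => //; apply: ltnW.
rewrite ler_pdivlMr // => le1; apply: le_trans (_ : _ <= 2 * (t%:R * ln 2)) _.
  by rewrite mulrA ler_pM2r // -natrM ler_nat; lia.
by rewrite ler_pM2l.
Qed.

Theorem theorem4p1 (R : realType) :
  exists (C : R) (c : nat), 0 < C /\
  forall (V : finType) (G : sgraph V) (K : {set V}) (n : nat)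
         (f : inputs n K -> bool) (eps n' : R),
    (1 < #|K|)%N ->
    0 <= eps ->
    0 < n' ->
    (forall a b : V, a \in K -> b \in K -> a != b ->
       exists xt : inputs n (K :\: ([set a] :|: [set b]))%SET,
         (n'%:E <= two_rounds eps
                     (fAB (A := [set a]%SET) (B := [set b]%SET) f xt))%E) ->
    (\big[Order.min/+oo]_(1 <= D < #|V|.+1) (n'%:E / ST R G K D + (D%:R)%:E)
       <= (C * ln ((#|V| + n)%:R : R) ^+ c)%:E * net_rounds eps G f)%E.
Proof.
have ln20 : 0 < ln 2 :> R by rewrite ln_gt0 // ltr1n.
have ln21 : ln 2 <= 1 :> R.
  by have := @le_ln1Dx R 1; rewrite (_ : 1 + 1 = 2) ?ltrN10 //; apply; lra.
(* The total will be at most [56 j r / ln 2], where 56 is 48 from the quotient by [ST] plus 8 from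
   the diameter; the bound [2 l / ln 2] on [j] doubles this to 112. *)
exists (112 / ln 2 ^+ 2), 1%N; split; first by rewrite divr_gt0 // exprn_gt0.
move=> V G K n f eps n' K1 eps0 n0 hard.
have KV : (#|K| <= #|V| + n)%N by rewrite (leq_trans (max_card _)) // leq_addr.
set l := ln (#|V| + n)%:R.
have l0 : 0 < l by rewrite ln_gt0 // ltr1n; apply: leq_trans K1 KV.
(* The positive factor is moved to the left so that the infimum can be bounded for each number of
   rounds [r] separately, and is then moved back. *)
rewrite expr1 -lee_pdivrMl; last by rewrite mulr_gt0 // divr_gt0 // exprn_gt0.
apply/ereal_infP => _ [r hr <-]; rewrite lee_pdivrMl; last first.
  by rewrite mulr_gt0 // divr_gt0 // exprn_gt0.
have wl := well_linked_of_protocol n0 hr hard.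
(* Distinct terminals are joined by a path of at most [2r] edges, so [r] is positive; this puts [D]
   below into the range of the minimum. *)
have r0 : (0 < r)%N.
  have /card_gt1P[a [b [aK bK ab]]] := K1.
  have [p [_ lp]] := well_linked_path wl aK bK ab.
  by case: r {hr wl} p lp => // -[|//] /= ab'; rewrite ab' eqxx in ab.
have V0 : (0 < #|V|)%N by rewrite (leq_trans _ (max_card (mem K))) // ltnW.
pose j := (trunc_log 2 #|K|).+1.
have hj : j%:R <= 2 * l / ln 2 := trunc_logS_le_ln R K1 KV.
have j0 : 0 < j%:R :> R by rewrite ltr0n.
have c0 : 0 < (2 * r.*2.+1)%:R / n' :> R by rewrite divr_gt0.
have Kj : (0 < #|K| <= 2 ^ j)%N by rewrite (ltnW K1) ltnW // trunc_log_ltn.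
have := ST_ge wl c0 (ltn0Sn _ : 0 < j)%N Kj.
set D := minn _ _; set s := ST _ _ _ _ => hs.
have D1 : (0 < D)%N by rewrite leq_min V0 andbT !muln_gt0 !double_gt0 r0.
have DV : (D <= #|V|)%N := geq_minr _ _.
apply: le_trans (_ : n'%:E / s + D%:R%:E <= _)%E.
  apply: le_trans (le_bigmin_nat _ _ D1 (DV : D.+1 <= #|V|.+1)%N) _.
  by rewrite big_ltn // ge_min lexx.
have v0 : 0 < ln 2 / (8 * j%:R * ((2 * r.*2.+1)%:R / n')) :> R.
  by rewrite divr_gt0 // mulr_gt0 // mulr_gt0.
have s1 : (n'%:E / s <= (16 * j%:R * r.*2.+1%:R / ln 2)%:E)%E.
  apply: le_trans (_ : _ <= n'%:E / (ln 2 / (8 * j%:R * ((2 * r.*2.+1)%:R / n')))%:E)%E _.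
    have s0 : (0 <= s)%E by apply: le_trans hs; rewrite lee_fin ltW.
    by rewrite lee_pmul2l ?lte_fin // lee_pV2 ?inE //= lee_fin ltW.
  rewrite inver gt_eqF // -EFinM lee_fin invf_div mulrCA natrM.
  rewrite le_eqVlt; apply/orP; left; apply/eqP; field.
  by rewrite !gt_eqF.
apply: le_trans (leeD2r _ s1) _; rewrite -EFinD -EFinM lee_fin.
have Dle : D%:R <= 8 * j%:R * r%:R :> R.
  rewrite -!natrM ler_nat; apply: leq_trans (geq_minl _ _) _; lia.
have r3 : r.*2.+1%:R <= 3 * r%:R :> R by rewrite -natrM ler_nat; lia.
have rp : 0 < r%:R :> R by rewrite ltr0n.
apply: le_trans (_ : 56 * (j%:R * r%:R) / ln 2 <= _).
  rewrite ler_pdivlMr // mulrDl divfK ?gt_eqF //.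
  have h1 : D%:R * ln 2 <= 8 * j%:R * r%:R :> R.
    by apply: le_trans Dle; rewrite ler_piMr.
  have h2 : 16 * j%:R * r.*2.+1%:R <= 16 * j%:R * (3 * r%:R) :> R.
    by rewrite ler_pM2l // mulr_gt0.
  by lra.
rewrite ler_pdivrMr //.
have -> : 112 / ln 2 ^+ 2 * l * r%:R * ln 2 = 56 * ((2 * l / ln 2) * r%:R).
  by field; rewrite gt_eqF.
by rewrite ler_pM2l // ler_pM2r.
Qed.
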